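(* For all integers $1\le i\le n$, the Stirling number of the first kind $s(n,i)$ satisfies $$s(n,i)=(-1)^{n+i}(n-1)!\sum_{\ell_1=1}^{n-1} \frac1{\ell_1}\sum_{\ell_2=1}^{\ell_1-1}\frac1{\ell_2}\dotsm \sum_{\ell_{i-2}=1}^{\ell_{i-3}-1}\frac1{\ell_{i-2}} \sum_{\ell_{i-1}=1}^{\ell_{i-2}-1}\frac1{\ell_{i-1}}.$$
   Context: The (signed) Stirling numbers of the first kind $s(n,k)$ are defined by $\prod_{k=0}^{n-1}(x-k)=\sum_{k=0}^n s(n,k)x^k$, or equivalently by $\frac{[\ln(1+x)]^m}{m!}=\sum_{k=m}^\infty\frac{s(k,m)}{k!}x^k$ for $|x|<1$. The nested sum has depth $i-1$: it is the sum of $\frac1{\ell_1\ell_2\cdots\ell_{i-1}}$ over all integers $n-1\ge\ell_1>\ell_2>\dots>\ell_{i-1}\ge1$. For $i=1$ (depth $0$) it is understood as $1$; empty sums of positive depth are $0$. *)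

(* Defs.v *)
From mathcomp Require Export all_boot all_order all_algebra.

Set Implicit Arguments.
Unset Strict Implicit.
Unset Printing Implicit Defensive.

Import GRing.Theory.
Local Open Scope ring_scope.

(* Signed Stirling numbers s(n, k): the coefficient of x^k in
   x (x - 1) ... (x - (n - 1)). *)
Definition stirling1 (n k : nat) : int :=
  (\prod_(j < n) ('X - (j%:Z)%:P) : {poly int})`_k.

(* The d-fold iterated sum whose outermost index runs over 1 <= l < m and
   each later index from 1 to the previous index minus one. *)
Fixpoint nested_harmonic (d m : nat) : rat :=
  if d is d'.+1 then \sum_(1 <= l < m) l%:R^-1 * nested_harmonic d' l else 1.

(* Main.v *)
(* The recurrence s(n+1, k+1) = s(n, k) - n s(n, k+1) and the splitting off of
   the term l = n from the outermost sum give both sides the same recursion. *)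
From mathcomp Require Import ring.
Require Import Defs.

Import GRing.Theory Num.Theory.
Local Open Scope ring_scope.

(** Divided by [(-1)^(n+d) (n+1)!], the recurrence for [s(n+2, d+2)] becomes exactly
    [nested_harmonicSS], so induction on [n], for all [d] at once, identifies the two sides. *)

Lemma stirling1SS n k :
  stirling1 n.+1 k.+1 = stirling1 n k - n%:Z * stirling1 n k.+1.
Proof. by rewrite /stirling1 big_ord_recr /= mulrBr coefB coefMX coefMC mulrC. Qed.

Lemma stirling1S0 n : stirling1 n.+1 0 = 0.
Proof. by rewrite /stirling1 big_ord_recl subr0 coefXM. Qed.

Lemma stirling11 k : stirling1 1 k.+1 = (k == 0)%:Z.
Proof. by rewrite /stirling1 big_ord1 subr0 coefX; case: k. Qed.

Lemma nested_harmonicSS d m :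
  nested_harmonic d.+1 m.+2 =
  nested_harmonic d.+1 m.+1 + m.+1%:R^-1 * nested_harmonic d m.+1.
Proof. by rewrite /= big_nat_recr. Qed.

Lemma stirling1_nested_harmonic n d :
  (stirling1 n.+1 d.+1)%:~R =
    (-1) ^+ (n + d) * (n`!)%:R * nested_harmonic d n.+1 :> rat.
Proof.
elim: n d => [|n IHn] [|d].
- by rewrite stirling11 !mulr1.
- by rewrite stirling11 /= big_geq // mulr0.
(* Depth 0: the term [s(n+1, 0)] vanishes, leaving a signed factorial. *)
- rewrite stirling1SS stirling1S0 sub0r mulrNz intrM IHn /= factS natrM.
  rewrite addSn exprS -pmulrn; ring.
- have n_neq0 : n.+1%:R != 0 :> rat by rewrite pnatr_eq0.
  rewrite stirling1SS intrB intrM !IHn nested_harmonicSS factS natrM -pmulrn.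
  (* With [n+1] abstracted to [x], the only side condition for [field] is [x != 0]. *)
  rewrite addSn addnS !exprS; move: n.+1%:R n_neq0 => x x_neq0.
  by field.
Qed.

Theorem corollary2p3 (n i : nat) (hi : (1 <= i)%N) (hin : (i <= n)%N) :
  (stirling1 n i)%:~R =
    (-1) ^+ (n + i) * ((n.-1)`!)%:R * nested_harmonic i.-1 n :> rat.
Proof.
case: i hi hin => // i _; case: n => // n _.
by rewrite stirling1_nested_harmonic addSn addnS !exprS !mulN1r opprK.
Qed.
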